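(* Let $G$ be a discrete group acting properly on a manifold $M$, let $H<G$ be a finite subgroup, not necessarily normal, with normalizer $N(H)$, and let $\rho:H\to U(V)$ be an irreducible finite-dimensional complex unitary representation such that for every $n\in N(H)$ the representation $h\mapsto\rho(n^{-1}hn)$ is equivalent to $\rho$. Assume that $M=\bigcup_{[g]\in G/N(H)}M^{gHg^{-1}}$ and that $H$ is maximal among the isotropy subgroups of points of $M$. Then restriction of bundles to $M^H$ gives a one-to-one correspondence $$\widetilde{\mathrm{Vect}}_G(M,\rho)\;\approx\;\mathrm{Vect}_{N(H)}(M^H,\rho).$$
   Context: $M^K$ denotes the fixed point set of a subgroup $K<G$. Under the stated assumptions $N(H)/H$ acts freely on $M^H$. Fix a finite-dimensional complex vector space $F$. $\mathrm{Vect}_{N(H)}(M^H,\rho)$: isomorphism classes of $N(H)$-equivariant complex vector bundles $\eta\to M^H$ such that $H$ has no fixed points in the total space of $\eta$ outside the zero section and such that $\eta$ is, as an $H$-equivariant bundle, isomorphic to $\eta_0\otimes V$, where $\eta_0$ is a complex vector bundle over $M^H$ with fiber $F$ and trivial $H$-action and $V$ is the trivial bundle with fiber $V$ on which $H$ acts fiberwise via $\rho$. $\widetilde{\mathrm{Vect}}_G(M,\rho)$: isomorphism classes of $G$-equivariant complex vector bundles $\xi\to M$ on which $G$ acts quasi-freely with (non-normal) stationary subgroup $H$, i.e. no conjugate of $H$ has fixed points in the total space of $\xi$ outside the zero section, and whose restriction to $M^H$ is of type $\rho$, i.e. as an $H$-equivariant bundle isomorphic to $\xi_0\otimes V$, where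 $\xi_0$ is a complex vector bundle over $M^H$ with fiber $F$ and trivial $H$-action and $V$ is the trivial bundle over $M^H$ with fiber $V$ on which $H$ acts fiberwise via $\rho$. In both cases isomorphisms are equivariant vector bundle isomorphisms covering an equivariant homeomorphism of the base that induces the identity of the orbit space ($M^H/N(H)$, respectively $M/G$). *)

(* Defs.v *)
From HB Require Import structures.
From mathcomp Require Import all_boot all_order all_algebra.
From mathcomp Require Import all_classical all_reals topology normedtype.
From mathcomp.real_closed Require Import complex.

Set Implicit Arguments.
Unset Strict Implicit.
Unset Printing Implicit Defensive.

Import Order.TTheory GRing.Theory Num.Theory numFieldNormedType.Exports.
Local Open Scope classical_set_scope.
Local Open Scope ring_scope.

(* Naming the structure, and not only the carrier R[i], lets the norm topology
   of numFieldType be inferred on complex numbers and on vectors. *)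
Definition cplx (R : realType) : numClosedFieldType := R[i].

Definition homeo (X Y : topologicalType) (f : X -> Y) : Prop :=
  continuous f /\
  exists g : Y -> X, [/\ cancel f g, cancel g f & continuous g].

Definition topological_manifold (R : realType) (n : nat) (M : topologicalType)
    : Prop :=
  [/\ hausdorff_space M, @second_countable M &
    forall x : M, exists (U : set M) (phi : M -> 'rV[R]_n)
                         (psi : 'rV[R]_n -> M),
      [/\ open U, U x & open (phi @` U)] /\
      [/\ forall y, U y -> {for y, continuous phi},
          forall y, U y -> psi (phi y) = y &
          forall v, (phi @` U) v -> {for v, continuous psi}]].

Lemma val_continuous (X : topologicalType) (A : set X) :
  continuous (fun x : A => val x).
Proof. exact: (@initial_continuous A X set_val). Qed.

Lemma continuous_at_subtype (X Y : topologicalType) (A : set Y) (f : X -> A)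
    (x : X) :
  {for x, continuous (fun z => val (f z))} -> {for x, continuous f}.
Proof.
move=> cf U [_ [[W oW <-] /= Wfx WU]]; apply: filterS (WU) _.
by apply: cf; exact: open_nbhs_nbhs.
Qed.

Lemma continuous_at_ptws (X Y : topologicalType) (I : Type)
    (f : X -> {ptws I -> Y}) (x : X) :
  (forall i, {for x, continuous (fun z => f z i)}) -> {for x, continuous f}.
Proof.
move=> cf; apply/cvg_sup => i U [_ [[W oW <-] /= Wfx WU]].
by apply: filterS (WU) _; apply: cf; exact: open_nbhs_nbhs.
Qed.

Lemma continuous_at_comp (X Y Z : topologicalType) (f : X -> Y) (g : Y -> Z)
    (x : X) :
  {for x, continuous f} -> {for f x, continuous g} ->
  {for x, continuous (fun z => g (f z))}.
Proof. exact: continuous_comp. Qed.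

Lemma continuous_at_pair (X Y Z : topologicalType) (f : X -> Y) (g : X -> Z)
    (x : X) :
  {for x, continuous f} -> {for x, continuous g} ->
  {for x, continuous (fun z => (f z, g z))}.
Proof. exact: cvg_pair. Qed.

Lemma continuous_fst (X Y : topologicalType) : continuous (@fst X Y).
Proof. by move=> p; exact: cvg_fst. Qed.

Lemma continuous_snd (X Y : topologicalType) : continuous (@snd X Y).
Proof. by move=> p; exact: cvg_snd. Qed.

Lemma continuous_at_mx (X Y : topologicalType) (m n : nat)
    (f : X -> 'M[Y]_(m, n)) (x : X) :
  (forall i j, {for x, continuous (fun z => f z i j)}) ->
  {for x, continuous f}.
Proof.
move=> cf U [P nP PU]; apply: filterS (_ : nbhs x (fun z => forall i j,
  P i j (f z i j))); first by move=> z Pz; exact: PU.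
apply: filter_forall => i; apply: filter_forall => j.
by apply: cf; exact: nP.
Qed.

Lemma eq_near_continuous (X Y : topologicalType) (f g : X -> Y) (x : X)
    (U : set X) :
  open U -> U x -> (forall z, U z -> f z = g z) ->
  {for x, continuous f} -> {for x, continuous g}.
Proof.
move=> oU Ux fg cf; rewrite /prop_for /continuous_at -(fg x Ux).
apply: cvg_trans cf; apply: near_eq_cvg; apply: filterS fg _.
exact: open_nbhs_nbhs.
Qed.

Section Groups.
Variable G : groupType.

Definition subgrp (K : groupClosed G) := {g : G | g \in K}.

Definition conjset (g : G) (A : set G) : set G :=
  [set (g * h * g^-1)%g | h in A].

Definition normalizer (H : {pred G}) : {pred G} :=
  fun g => `[< conjset g [set` H] = [set` H] >].

Lemma normalizerP (H : {pred G}) g :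
  reflect (conjset g [set` H] = [set` H]) (g \in normalizer H).
Proof. exact: asboolP. Qed.

Lemma conjsetM g h A : conjset (g * h) A = conjset g (conjset h A).
Proof.
rewrite /conjset image_comp; apply: eq_imagel => x _ /=.
by rewrite invgM !mulgA.
Qed.

Lemma conjset1 A : conjset 1 A = A.
Proof.
rewrite /conjset -[RHS]image_id; apply: eq_imagel => x _.
by rewrite invg1 mul1g mulg1.
Qed.

Lemma normalizer_closed (H : {pred G}) : group_closed (normalizer H).
Proof.
split; first by apply/normalizerP; exact: conjset1.
move=> g h /normalizerP gH /normalizerP hH; apply/normalizerP.
by rewrite conjsetM -[in conjset h^-1 _]hH -[conjset h^-1 _]conjsetM mulVg
  conjset1.
Qed.

HB.instance Definition _ (H : {pred G}) :=
  isMulClosed.Build G (normalizer H) (group_closedM (normalizer_closed H)).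
HB.instance Definition _ (H : {pred G}) :=
  isMul1Closed.Build G (normalizer H) (proj1 (normalizer_closed H)).
HB.instance Definition _ (H : {pred G}) :=
  isInvClosed.Build G (normalizer H) (group_closedV (normalizer_closed H)).

Lemma sub_normalizer (H : groupClosed G) h : h \in H -> h \in normalizer H.
Proof.
move=> hH; apply/normalizerP/seteqP; split => [_ [k kH <-]|k kH] /=.
  by rewrite gpredM ?gpredV// gpredM.
exists (h^-1 * k * h)%g; first by rewrite /= gpredM// gpredM// gpredV.
by rewrite !mulgA mulgV mul1g -mulgA mulgV mulg1.
Qed.

End Groups.

HB.instance Definition _ (G : groupType) (K : groupClosed G) :=
  [isSub for (fun x : subgrp K => sval x)].
HB.instance Definition _ (G : groupType) (K : groupClosed G) :=
  [Choice of subgrp K by <:].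

Lemma groupClosedP (G : groupType) (K : groupClosed G) : group_closed K.
Proof. by split; [exact: gpred1 | exact: gpredF]. Qed.
HB.instance Definition _ (G : groupType) (K : groupClosed G) :=
  SubChoice_isSubGroup.Build G (fun x => x \in K) (subgrp K) (groupClosedP K).

Record action (K : groupType) (X : topologicalType) := Action {
  act :> K -> X -> X;
  act1 : forall x, act 1%g x = x;
  actM : forall g h x, act (g * h)%g x = act g (act h x);
  act_cont : forall g, continuous (act g) }.

Section Actions.
Variables (G : groupType) (M : topologicalType) (a : action G M).

(* For a discrete G and a locally compact Hausdorff M this is properness of
   (g, x) |-> (g x, x). *)
Definition proper_action : Prop :=
  forall C : set M, compact C -> finite_set [set g | (a g @` C) `&` C !=set0].

Definition fixpt (A : set G) : set M := [set x | forall g, A g -> a g x = x].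

Definition isotropy (x : M) : set G := [set g | a g x = x].

Definition maximal_isotropy (H : set G) : Prop :=
  (exists x, isotropy x = H) /\
  (forall x, H `<=` isotropy x -> isotropy x = H).

Variables (K : groupClosed G) (A : set M).
Hypothesis sA : forall g x, g \in K -> A x -> A (a g x).

Definition subact (g : subgrp K) (x : A) : A :=
  exist _ (a (val g) (val x)) (mem_set (sA (valP g) (set_mem (valP x)))).

Lemma subact1 x : subact 1%g x = x.
Proof. by apply/val_inj; rewrite /= act1. Qed.

Lemma subactM g h x : subact (g * h)%g x = subact g (subact h x).
Proof. by apply/val_inj; rewrite /= actM. Qed.

Lemma subact_cont g : continuous (subact g).
Proof.
move=> x; apply: continuous_at_subtype.
apply: (@continuous_at_comp A M M (fun z => val z)); last exact: act_cont.
exact: val_continuous.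
Qed.

Definition sub_action : action (subgrp K) A :=
  Action subact1 subactM subact_cont.

End Actions.

Lemma fixpt_normalizer (G : groupType) (M : topologicalType) (a : action G M)
    (H : groupClosed G) (g : G) (x : M) :
  g \in normalizer H -> fixpt a [set` H] x -> fixpt a [set` H] (a g x).
Proof.
move=> /normalizerP gH fx h hH; have : conjset g [set` H] h by rewrite gH.
move=> [k kH <-]; rewrite -actM -mulgA mulVg mulg1 actM.
by rewrite fx.
Qed.

Definition fixpt_action (G : groupType) (M : topologicalType) (a : action G M)
    (H : groupClosed G) :
    action (subgrp (normalizer H)) (fixpt a [set` H]) :=
  sub_action (@fixpt_normalizer G M a H).

Section VectorBundles.
Variable R : realType.
Local Notation C := (cplx R).

(* vadd x y is only meaningful when x and y lie in the same fibre. *)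
Record vfamily (B : topologicalType) := VFamily {
  tot :> topologicalType;
  proj : tot -> B;
  vzero : B -> tot;
  vadd : tot -> tot -> tot;
  vscale : C -> tot -> tot;
  proj_cont : continuous proj;
  proj_zero : forall b, proj (vzero b) = b;
  proj_add : forall x y, proj x = proj y -> proj (vadd x y) = proj x;
  proj_scale : forall c x, proj (vscale c x) = proj x }.

(* e |-> (proj e, phi e) is a homeomorphism from the part over U onto U x C^k,
   with inverse psi, and phi is linear on fibres. *)
Record trivialization (B : topologicalType) (E : vfamily B) (U : set B)
    (k : nat) (phi : E -> 'rV[C]_k) (psi : B * 'rV[C]_k -> E) : Prop := Triv {
  triv_cont : forall e, U (proj e) -> {for e, continuous phi};
  triv_inv_cont : forall p, U p.1 -> {for p, continuous psi};
  triv_proj : forall p, U p.1 -> proj (psi p) = p.1;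
  trivK : forall p, U p.1 -> phi (psi p) = p.2;
  triv_invK : forall e, U (proj e) -> psi (proj e, phi e) = e;
  triv_zero : forall b, U b -> phi (vzero E b) = 0;
  triv_add : forall x y, U (proj x) -> proj x = proj y ->
    phi (vadd x y) = phi x + phi y;
  triv_scale : forall c x, U (proj x) -> phi (vscale c x) = c *: phi x }.

(* The vector space axioms on fibres follow from local triviality. The rank is
   only required to be locally constant. *)
Record vbundle (B : topologicalType) := VBundle {
  vfam :> vfamily B;
  loc_triv : forall b : B, exists (U : set B) (k : nat) phi psi,
    [/\ open U, U b & trivialization (E := vfam) U (k := k) phi psi] }.

Definition has_fiber (B : topologicalType) (E : vbundle B) (F : vectType C)
    : Prop :=
  forall b : B, exists f : F -> E,
    [/\ injective f, range f = [set e | proj e = b],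
        forall u v, f (u + v) = vadd (f u) (f v) &
        forall c u, f (c *: u) = vscale c (f u)].

Definition vbundle_iso (B : topologicalType) (E E' : vbundle B) (f : B -> B)
    (Phi : E -> E') : Prop :=
  [/\ homeo f, homeo Phi, forall e, proj (Phi e) = f (proj e),
      forall x y, proj x = proj y -> Phi (vadd x y) = vadd (Phi x) (Phi y) &
      forall c x, Phi (vscale c x) = vscale c (Phi x)].

Section Restriction.
Variables (B : topologicalType) (E : vbundle B) (A : set B).

Definition rtot : set E := [set e | A (proj e)].

Definition rproj (e : rtot) : A :=
  exist _ (proj (val e)) (mem_set (set_mem (valP e))).

Lemma rzero_subproof (b : A) : vzero E (val b) \in rtot.
Proof.
by apply/mem_set; rewrite /rtot /= proj_zero; exact: set_mem (valP b).
Qed.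

Definition rzero (b : A) : rtot := exist _ (vzero E (val b)) (rzero_subproof b).

Definition radd (x y : rtot) : rtot := insubd x (vadd (val x) (val y)).

Lemma rscale_subproof c (x : rtot) : vscale c (val x) \in rtot.
Proof.
by apply/mem_set; rewrite /rtot /= proj_scale; exact: set_mem (valP x).
Qed.

Definition rscale c (x : rtot) : rtot :=
  exist _ (vscale c (val x)) (rscale_subproof c x).

Lemma val_radd x y : rproj x = rproj y ->
  val (radd x y) = vadd (val x) (val y).
Proof.
move=> /(congr1 val)/= xy; rewrite /radd insubdK//.
by apply/mem_set; rewrite /rtot /= proj_add//; exact: set_mem (valP x).
Qed.

Lemma rproj_cont : continuous rproj.
Proof.
move=> x; apply: continuous_at_subtype.
apply: (@continuous_at_comp rtot E B (fun z => val z)); last exact: proj_cont.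
exact: val_continuous.
Qed.

Lemma rproj_zero b : rproj (rzero b) = b.
Proof. by apply/val_inj; rewrite /= proj_zero. Qed.

Lemma rproj_add x y : rproj x = rproj y -> rproj (radd x y) = rproj x.
Proof.
move=> xy; apply/val_inj; rewrite /= val_radd// proj_add//.
exact: (congr1 val xy).
Qed.

Lemma rproj_scale c x : rproj (rscale c x) = rproj x.
Proof. by apply/val_inj; rewrite /= proj_scale. Qed.

Definition restr_fam : vfamily A :=
  VFamily rproj_cont rproj_zero rproj_add rproj_scale.

Lemma restr_loc_triv (b : A) : exists (U : set A) (k : nat) phi psi,
  [/\ open U, U b & trivialization (E := restr_fam) U (k := k) phi psi].
Proof.
have [U [k [phi [psi [oU Ub T]]]]] := loc_triv E (val b).
exists (val @^-1` U), k, (phi \o val),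
  (fun p => insubd (rzero p.1) (psi (val p.1, p.2))).
have inr (p : A * 'rV[C]_k) : U (val p.1) -> psi (val p.1, p.2) \in rtot.
  move=> Up; apply/mem_set; rewrite /rtot /= (triv_proj T)//=.
  exact: set_mem (valP p.1).
have oV : open ((val : A -> B) @^-1` U).
  by apply: open_comp => // ? _; exact: val_continuous.
split => //; split => /=.
- move=> e Ue; apply: (@continuous_at_comp rtot E _ (fun z => val z)).
    exact: val_continuous.
  exact: (triv_cont T).
- move=> p Up.
  apply: (@continuous_at_subtype (A * 'rV[C]_k)%type E rtot).
  have vfst : continuous (fun z : A * 'rV[C]_k => val z.1).
    move=> z; apply: (@continuous_at_comp _ A B fst).
      exact: continuous_fst.
    exact: val_continuous.
  apply: (@eq_near_continuous (A * 'rV[C]_k)%type E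
    (fun z => psi (val z.1, z.2)) _ p ((fun z => val z.1) @^-1` U)) => //.
  - by apply: open_comp => // ? _; exact: vfst.
  - by move=> z Uz; rewrite insubdK ?inr.
  apply: (@continuous_at_comp (A * 'rV[C]_k)%type (B * 'rV[C]_k)%type E
    (fun z => (val z.1, z.2)) psi); last exact: (triv_inv_cont T).
  apply: (@continuous_at_pair (A * 'rV[C]_k)%type B 'rV[C]_k).
    exact: vfst.
  exact: continuous_snd.
- move=> p Up; apply/val_inj; rewrite /= insubdK; [|exact: inr].
  by rewrite (triv_proj T).
- by move=> p Up; rewrite insubdK; [rewrite (trivK T)|exact: inr].
- move=> e Ue; apply/val_inj; rewrite insubdK /=; last first.
    exact: (inr (rproj e, phi (val e))).
  by rewrite (triv_invK T).
- by move=> c Uc; exact: (triv_zero T).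
- move=> x y Ux xy; rewrite val_radd// (triv_add T)//.
  exact: (congr1 val xy).
- by move=> c x Ux; exact: (triv_scale T).
Qed.

Definition restr : vbundle A := VBundle restr_loc_triv.

End Restriction.
Lemma fibre_coord (B : topologicalType) (E : vbundle B) (b : B) :
  exists (k : nat) (phi : E -> 'rV[C]_k),
  [/\ forall x y, proj x = b -> proj y = b -> phi x = phi y -> x = y,
      phi (vzero E b) = 0,
      forall x y, proj x = b -> proj y = b -> phi (vadd x y) = phi x + phi y &
      forall c x, proj x = b -> phi (vscale c x) = c *: phi x].
Proof.
have [U [k [phi [psi [_ Ub T]]]]] := loc_triv E b; exists k, phi; split.
- move=> x y xb yb xy; have := triv_invK T (e := x).
  have := triv_invK T (e := y); rewrite xb yb xy.
  by move=> /(_ Ub) yE /(_ Ub) xE; rewrite -xE.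
- exact: (triv_zero T).
- by move=> x y xb yb; rewrite (triv_add T) ?xb ?yb.
- by move=> c x xb; rewrite (triv_scale T) ?xb.
Qed.

(* The tensor product of E with the trivial bundle with fibre V. The fibre
   E_b (x) V is modelled as the space of linear maps V^* -> E_b, the elementary
   tensor e (x) v being l |-> l(v) e. *)
Section Tensor.
Variables (B : topologicalType) (E : vbundle B) (V : vectType C).
Local Notation dual := 'Hom(V, C^o).

Definition ttot : set {ptws dual -> E} :=
  [set t | [/\ forall l, proj (t l) = proj (t 0),
               forall l m, t (l + m) = vadd (t l) (t m) &
               forall c l, t (c *: l) = vscale c (t l)]].

Definition tval (t : ttot) : dual -> E := val t.

Definition tproj (t : ttot) : B := proj (tval t 0).

Lemma ttotP (t : ttot) :
  [/\ forall l, proj (tval t l) = tproj t,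
      forall l m, tval t (l + m) =
        vadd (tval t l) (tval t m) &
      forall c l, tval t (c *: l) =
        vscale c (tval t l)].
Proof. exact: set_mem (valP t). Qed.

Lemma tzero_subproof (b : B) : ((fun=> vzero E b) : {ptws dual -> E}) \in ttot.
Proof.
have [k [phi [phiI phi0 phiD phiZ]]] := fibre_coord E b.
apply/mem_set; split=> // [_ _|c _]; apply: phiI; rewrite ?proj_zero//.
- by rewrite proj_add ?proj_zero.
- by rewrite phiD ?proj_zero// phi0 addr0.
- by rewrite proj_scale proj_zero.
- by rewrite phiZ ?proj_zero// phi0 scaler0.
Qed.

Definition tzero (b : B) : ttot := 
  exist _ ((fun=> vzero E b) : {ptws dual -> E}) (tzero_subproof b).

Definition tadd (t s : ttot) : ttot :=
  insubd t ((fun l => vadd (tval t l) (tval s l))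
            : {ptws dual -> E}).

Lemma tadd_subproof (t s : ttot) : tproj t = tproj s ->
  ((fun l => vadd (tval t l) (tval s l))
     : {ptws dual -> E}) \in ttot.
Proof.
move=> ts; have [tp tD tZ] := ttotP t; have [sp sD sZ] := ttotP s.
have [k [phi [phiI phi0 phiD phiZ]]] := fibre_coord E (tproj t).
have pD l : proj (vadd (tval t l) (tval s l)) =
    tproj t.
  by rewrite proj_add ?tp// sp.
apply/mem_set; split=> [l|l m|c l]; first by rewrite !pD.
- apply: phiI; rewrite ?pD//; first by rewrite proj_add !pD.
  by rewrite !phiD ?pD ?tp ?sp// tD sD !phiD ?tp ?sp// addrACA.
- apply: phiI; rewrite ?pD ?proj_scale ?pD//.
  rewrite phiZ ?pD// !phiD ?tp ?sp//.
  by rewrite tZ sZ !phiZ ?tp ?sp// scalerDr.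
Qed.

Lemma tscale_subproof (c : C) (t : ttot) :
  ((fun l => vscale c (tval t l)) : {ptws dual -> E}) \in ttot.
Proof.
have [tp tD tZ] := ttotP t.
have [k [phi [phiI phi0 phiD phiZ]]] := fibre_coord E (tproj t).
apply/mem_set; split=> [l|l m|d l]; first by rewrite !proj_scale !tp.
- apply: phiI; rewrite ?proj_scale ?tp// ?proj_add ?proj_scale ?tp//.
  by rewrite phiD ?proj_scale ?tp// !phiZ ?tp// tD phiD ?tp// scalerDr.
- apply: phiI; rewrite ?proj_scale ?tp//.
  by rewrite tZ !phiZ ?proj_scale ?tp// !scalerA mulrC.
Qed.

Definition tscale (c : C) (t : ttot) : ttot := 
  exist _ ((fun l => vscale c (tval t l)) : {ptws dual -> E})
    (tscale_subproof c t).

Lemma val_tadd (t s : ttot) : tproj t = tproj s ->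
  tval (tadd t s) =
  (fun l => vadd (tval t l) (tval s l)).
Proof. by move=> ts; rewrite /tval insubdK//; exact: tadd_subproof. Qed.

Lemma eval_cont (l : dual) : continuous (tval^~ l).
Proof.
move=> t; apply: (@continuous_at_comp ttot {ptws dual -> E} E
  (fun z => val z) (fun f => f l)).
  exact: val_continuous.
exact: (@proj_continuous dual (fun=> E) l).
Qed.

Lemma tproj_cont : continuous tproj.
Proof.
move=> t; apply: (@continuous_at_comp ttot E B
  (fun z => tval z 0)).
  exact: eval_cont.
exact: proj_cont.
Qed.

Lemma tproj_zero b : tproj (tzero b) = b.
Proof. by rewrite /tproj /= proj_zero. Qed.

Lemma tproj_add t s : tproj t = tproj s -> tproj (tadd t s) = tproj t.
Proof. by move=> ts; rewrite {1}/tproj val_tadd// proj_add. Qed.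

Lemma tproj_scale c t : tproj (tscale c t) = tproj t.
Proof. by rewrite /tproj /= proj_scale. Qed.

Definition tensor_fam : vfamily B :=
  VFamily tproj_cont tproj_zero tproj_add tproj_scale.

Definition dual_coord (i : 'I_(\dim {:V})) : dual :=
  linfun (coord (vbasis {:V}) i : V -> C^o).

Lemma dual_coordE (l : dual) :
  l = \sum_(i < \dim {:V}) (l (vbasis {:V})`_i : C) *: dual_coord i.
Proof.
apply/lfunP => v; rewrite sum_lfunE [in LHS](coord_vbasis (memvf v)).
rewrite linear_sum; apply: eq_bigr => i _.
by rewrite scale_lfunE lfunE linearZ; exact: mulrC.
Qed.

Lemma phi_tval (t : ttot) (k : nat) (phi : E -> 'rV[C]_k) :
  (forall x y, proj x = tproj t -> proj y = tproj t ->
    phi (vadd x y) = phi x + phi y) ->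
  (forall c x, proj x = tproj t -> phi (vscale c x) = c *: phi x) ->
  forall l, phi (tval t l) =
    \sum_(i < \dim {:V})
      (l (vbasis {:V})`_i : C) *: phi (tval t (dual_coord i)).
Proof.
move=> phiD phiZ l; have [tp tD tZ] := ttotP t; rewrite {1}(dual_coordE l).
rewrite (big_morph (fun m => phi (tval t m)) (id1 := 0) (op1 := +%R)).
- by apply: eq_bigr => i _; rewrite tZ phiZ.
- by move=> x y; rewrite tD phiD.
- by rewrite -(scale0r 0) tZ phiZ// scale0r.
Qed.

Lemma tensor_loc_triv (b : B) : exists (U : set B) (k : nat) phi psi,
  [/\ open U, U b & trivialization (E := tensor_fam) U (k := k) phi psi].
Proof.
have [U [k [phi [psi [oU Ub T]]]]] := loc_triv E b.
pose Phi (t : ttot) : 'rV[C]_(\dim {:V} * k) :=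
  mxvec (\matrix_(i < \dim {:V}, j < k) phi (tval t (dual_coord i)) 0 j).
pose lin (l : dual) (w : 'rV[C]_(\dim {:V} * k)) : 'rV[C]_k :=
  \sum_(i < \dim {:V}) (l (vbasis {:V})`_i : C) *: row i (vec_mx w).
pose psit (p : B * 'rV[C]_(\dim {:V} * k)) : {ptws dual -> E} :=
  fun l => psi (p.1, lin l p.2).
exists U, (\dim {:V} * k)%N, Phi, (fun p => insubd (tzero p.1) (psit p)).
have linD l m w : lin (l + m) w = lin l w + lin m w.
  rewrite /lin -big_split; apply: eq_bigr => i _ /=.
  by rewrite add_lfunE scalerDl.
have linZ c l w : lin (c *: l) w = c *: lin l w.
  rewrite /lin scaler_sumr; apply: eq_bigr => i _ /=.
  by rewrite scale_lfunE scalerA.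
have psi_inj x y : U (proj x) -> proj x = proj y -> phi x = phi y -> x = y.
  move=> Ux xy pxy; rewrite -(triv_invK T Ux) xy pxy.
  by rewrite (triv_invK T)// -xy.
have inT p : U p.1 -> psit p \in ttot.
  move=> Up; have pp v : proj (psi (p.1, v)) = p.1 by rewrite (triv_proj T).
  apply/mem_set; split=> [l|l m|c l]; rewrite /psit ?pp//.
  - apply: psi_inj; rewrite ?pp// ?proj_add ?pp//.
    by rewrite (triv_add T) ?pp// !(trivK T)//= linD.
  - apply: psi_inj; rewrite ?pp// ?proj_scale ?pp//.
    by rewrite (triv_scale T) ?pp// !(trivK T)//= linZ.
have phiT (t : ttot) : U (tproj t) -> forall l, phi (tval t l) =
    \sum_(i < \dim {:V})
      (l (vbasis {:V})`_i : C) *: phi (tval t (dual_coord i)).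
  move=> Ut; apply: phi_tval => [x y xt yt|c x xt].
    by rewrite (triv_add T) ?xt ?yt.
  by rewrite (triv_scale T) ?xt.
have linPhi (t : ttot) l : U (tproj t) -> lin l (Phi t) = phi (tval t l).
  move=> Ut; rewrite phiT// /lin /Phi mxvecK; apply: eq_bigr => i _.
  by congr (_ *: _); apply/rowP => j; rewrite !mxE.
have lin_dual w (i : 'I_(\dim {:V})) : lin (dual_coord i) w = row i (vec_mx w).
  have fV := basis_free (vbasisP {:V}).
  rewrite /lin (bigD1 i)//= big1 ?addr0 => [|j ji].
    by rewrite lfunE /= coord_free// eqxx scale1r.
  by rewrite lfunE /= coord_free// (negPf ji) scale0r.
have lin_cont l : continuous (lin l).
  apply: continuous_big => [|i _ w].
    exact: add_continuous.
  apply: continuous_at_mx => u j.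
  rewrite (_ : (fun _ => _) = fun w : 'rV[C]_(\dim {:V} * k) =>
    (l (vbasis {:V})`_i : C) * w 0 (mxvec_index i j)).
    apply: (@continuous_at_comp 'rV[C]_(\dim {:V} * k) C C).
      exact: coord_continuous.
    exact: mulrl_continuous.
  by apply/funext => z; rewrite !mxE.
split=> //; split=> /=.
- move=> t Ut; apply: continuous_at_mx => u ij.
  case/mxvec_indexP: ij => i j.
  rewrite (_ : (fun _ => _) = fun t : ttot =>
    phi (tval t (dual_coord i)) 0 j).
    apply: (@continuous_at_comp ttot 'rV[C]_k C
      (fun t => phi (tval t (dual_coord i))) (fun v => v 0 j)).
      apply: (@continuous_at_comp ttot E 'rV[C]_k (tval^~ (dual_coord i)) phi).
        exact: eval_cont.
      by apply: (triv_cont T); have [-> _ _] := ttotP t.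
    exact: coord_continuous.
  by apply/funext => z; rewrite ord1 mxvecE mxE.
- move=> p Up.
  apply: (@continuous_at_subtype (B * 'rV[C]_(\dim {:V} * k))%type
    {ptws dual -> E} ttot).
  apply: (@eq_near_continuous (B * 'rV[C]_(\dim {:V} * k))%type {ptws dual -> E}
    psit _ p (fst @^-1` U)) => //.
  + by apply: open_comp => // ? _; exact: continuous_fst.
  + by move=> z Uz; rewrite insubdK//; exact: inT.
  apply: (@continuous_at_ptws (B * 'rV[C]_(\dim {:V} * k))%type E dual) => l.
  apply: (@continuous_at_comp (B * 'rV[C]_(\dim {:V} * k))%type
    (B * 'rV[C]_k)%type E (fun z => (z.1, lin l z.2)) psi); last first.
    exact: (triv_inv_cont T).
  apply: (@continuous_at_pair (B * 'rV[C]_(\dim {:V} * k))%type B 'rV[C]_k).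
    exact: continuous_fst.
  apply: (@continuous_at_comp (B * 'rV[C]_(\dim {:V} * k))%type
    'rV[C]_(\dim {:V} * k) 'rV[C]_k).
    exact: continuous_snd.
  exact: lin_cont.
- move=> p Up; rewrite /tproj /tval insubdK; last exact: inT.
  by rewrite /psit (triv_proj T).
- move=> p Up; rewrite /Phi /tval insubdK; last exact: inT.
  rewrite -[RHS]vec_mxK; congr mxvec; apply/matrixP => i j.
  by rewrite mxE /psit (trivK T)// lin_dual mxE.
- move=> t Ut; apply/val_inj; rewrite insubdK; last first.
    exact: inT (tproj t, Phi t) _.
  apply/funext => l; rewrite /psit /= linPhi//.
  have [tp _ _] := ttotP t; apply: psi_inj.
  + by rewrite (triv_proj T).
  + by rewrite (triv_proj T)// -tp.
  + by rewrite (trivK T).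
- move=> c Uc; rewrite /Phi -[RHS]vec_mxK linear0; congr mxvec.
  by apply/matrixP => i j; rewrite !mxE /= (triv_zero T)// mxE.
- move=> t s Ut ts; rewrite /Phi -linearD; congr mxvec.
  have [tp _ _] := ttotP t; have [sp _ _] := ttotP s.
  by apply/matrixP => i j; rewrite !mxE val_tadd// (triv_add T) ?tp ?sp// mxE.
- move=> c t Ut; rewrite /Phi -linearZ; congr mxvec.
  have [tp _ _] := ttotP t.
  by apply/matrixP => i j; rewrite !mxE /= (triv_scale T) ?tp// mxE.
Qed.

Definition tensor : vbundle B := VBundle tensor_loc_triv.

(* id (x) f *)
Lemma tensor_map_subproof (f : 'End(V)) (t : tensor) :
  ((fun l => tval t (l \o f)%VF) : {ptws dual -> E})
    \in ttot.
Proof.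
have [tp tD tZ] := ttotP t; apply/mem_set; split=> [l|l m|c l].
- by rewrite !tp.
- by rewrite comp_lfunDl tD.
- by rewrite -comp_lfunZl tZ.
Qed.

Definition tensor_map (f : 'End(V)) (t : tensor) : tensor :=
  
  exist _ ((fun l => tval t (l \o f)%VF) : {ptws dual -> E})
    (tensor_map_subproof f t).

End Tensor.
Record ebundle (K : groupType) (B : topologicalType) (a : action K B) :=
  EBundle {
    ebun :> vbundle B;
    eact : action K ebun;
    proj_act : forall g e, proj (eact g e) = a g (proj e);
    act_add : forall g x y, proj x = proj y ->
      eact g (vadd x y) = vadd (eact g x) (eact g y);
    act_scale : forall g c x, eact g (vscale c x) = vscale c (eact g x) }.

(* The third clause says that f induces the identity of the orbit space. *)
Definition ebundle_iso (K : groupType) (B : topologicalType) (a : action K B)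
    (xi xi' : ebundle a) : Prop :=
  exists (f : B -> B) (Phi : xi -> xi'),
    [/\ vbundle_iso f Phi, forall g b, f (a g b) = a g (f b),
        forall b, exists g, f b = a g b &
        forall g e, Phi (eact xi g e) = eact xi' g (Phi e)].

Definition no_fixed_points (K : groupType) (B : topologicalType)
    (a : action K B) (xi : ebundle a) (A : set K) : Prop :=
  forall e : xi, (forall g, A g -> eact xi g e = e) -> e = vzero xi (proj e).

Section EquivariantRestriction.
Variables (G : groupType) (M : topologicalType) (a : action G M).
Variables (xi : ebundle a) (K : groupClosed G) (A : set M).
Hypothesis sA : forall g x, g \in K -> A x -> A (a g x).

Lemma rtot_stable g (e : xi) :
  g \in K -> @rtot _ xi A e -> @rtot _ xi A (eact xi g e).
Proof. by move=> gK Ae; rewrite /rtot /= proj_act; exact: sA. Qed.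

Definition ract : action (subgrp K) (restr xi A) := sub_action rtot_stable.

Lemma rproj_act g e : proj (ract g e) = sub_action sA g (proj e).
Proof. by apply/val_inj; rewrite /= proj_act. Qed.

Lemma ract_add g (x y : restr xi A) : proj x = proj y ->
  ract g (vadd x y) = vadd (ract g x) (ract g y).
Proof.
move=> xy; apply/val_inj; rewrite val_radd.
  rewrite /= (val_radd xy) act_add//; exact: (congr1 val xy).
by rewrite -[rproj _]/(proj (ract g x)) rproj_act xy -rproj_act.
Qed.

Lemma ract_scale g c (x : restr xi A) :
  ract g (vscale c x) = vscale c (ract g x).
Proof. by apply/val_inj; rewrite /= act_scale. Qed.

Definition erestr : ebundle (sub_action sA) :=
  EBundle rproj_act ract_add ract_scale.

End EquivariantRestriction.

Section Representations.
Variables (K : groupType) (V : vectType C).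

Definition unitary_representation (dotV : {dot V for Num.conj})
    (rho : K -> 'End(V)) : Prop :=
  [/\ rho 1%g = \1%VF, forall g h, rho (g * h)%g = (rho g \o rho h)%VF &
      forall g, isometry dotV dotV (rho g)].

Definition irreducible (rho : K -> 'End(V)) : Prop :=
  {:V}%VS != 0%VS /\
  forall U : {vspace V}, (forall g, rho g @: U <= U)%VS ->
    U = 0%VS \/ U = {:V}%VS.

Definition equivalent_representations (rho sigma : K -> 'End(V)) : Prop :=
  exists T : 'End(V), lker T == 0%VS /\
    forall g, (T \o rho g = sigma g \o T)%VF.

End Representations.

Section Classes.
Variables (G : groupType) (M : topologicalType) (a : action G M).
Variables (H : groupClosed G) (V F : vectType C) (rho : subgrp H -> 'End(V)).

Lemma conj_subproof (n : subgrp (normalizer H)) (h : subgrp H) :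
  ((val n)^-1 * val h * val n)%g \in H.
Proof.
have /normalizerP nH : (val n)^-1%g \in normalizer H by rewrite gpredV (valP n).
have : conjset (val n)^-1 [set` H] ((val n)^-1 * val h * val n)%g.
  by exists (val h); [exact: (valP h) | rewrite invgK].
by rewrite nH.
Qed.

Definition conj_representation (n : subgrp (normalizer H)) (h : subgrp H) :
  'End(V) := rho (exist _ ((val n)^-1 * val h * val n)%g (conj_subproof n h)).

Definition to_normalizer (h : subgrp H) : subgrp (normalizer H) :=
  exist _ (val h) (sub_normalizer (valP h)).

(* Since H acts trivially on M^H, the isomorphism covers the identity. *)
Definition of_type (eta : ebundle (fixpt_action a H)) : Prop :=
  exists (eta0 : vbundle (fixpt a [set` H])) (Phi : eta -> tensor eta0 V),
    [/\ has_fiber eta0 F, vbundle_iso id Phi &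
        forall h e, Phi (eact eta (to_normalizer h) e) =
          tensor_map (rho h) (Phi e)].

Definition restr_fixpt (xi : ebundle a) : ebundle (fixpt_action a H) :=
  erestr xi (@fixpt_normalizer G M a H).

Definition normalizer_bundle (eta : ebundle (fixpt_action a H)) : Prop :=
  no_fixed_points eta (range to_normalizer) /\ of_type eta.

Definition quasi_free_bundle (xi : ebundle a) : Prop :=
  (forall g, no_fixed_points xi (conjset g [set` H])) /\
  of_type (restr_fixpt xi).

End Classes.

(* The type set of MathComp-Analysis lives in too small a universe to hold sets
   of bundles, hence the plain predicates. *)
Section IsoClasses.
Variables (K : groupType) (B : topologicalType) (a : action K B).
Variable P : ebundle a -> Prop.

Definition iso_class (xi : ebundle a) : ebundle a -> Prop :=
  fun xi' => P xi' /\ ebundle_iso xi xi'.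

Definition iso_classes : Type :=
  {c : ebundle a -> Prop | exists2 xi, P xi & c = iso_class xi}.

Definition class_of (xi : ebundle a) (Pxi : P xi) : iso_classes :=
  exist _ (iso_class xi) (ex_intro2 _ _ xi Pxi erefl).

End IsoClasses.

Definition Vect_normalizer (G : groupType) (M : topologicalType)
    (a : action G M) (H : groupClosed G) (V F : vectType C)
    (rho : subgrp H -> 'End(V)) : Type :=
  iso_classes (@normalizer_bundle G M a H V F rho).

Definition Vect_quasi_free (G : groupType) (M : topologicalType)
    (a : action G M) (H : groupClosed G) (V F : vectType C)
    (rho : subgrp H -> 'End(V)) : Type :=
  iso_classes (@quasi_free_bundle G M a H V F rho).

End VectorBundles.

(* Main.v *)
(* The conjugates of M^H cover M, and maximality of H makes every isotropy group
   a conjugate of H; so M is the disjoint union of the translates of M^H, and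
   g M^H meets M^H only when g normalizes H. Properness makes isotropy groups
   upper semicontinuous, hence M^H is open and M = G x_{N(H)} M^H as a space.
   An equivariant map out of M, or out of a bundle over M, is therefore the same
   as an N(H)-equivariant map out of the part over M^H, and the inverse of
   restriction is induction eta |-> G x_{N(H)} eta. *)
Require Import Defs.
From HB Require Import structures.
From mathcomp Require Import all_boot all_order all_algebra.
From mathcomp Require Import all_classical all_reals interval_inference.
From mathcomp Require Import topology normedtype.
Import Order.TTheory GRing.Theory Num.Theory numFieldNormedType.Exports.
Local Open Scope classical_set_scope.
Local Open Scope ring_scope.
(* [proj] also names a projection of product spaces. *)
Import Defs.

Set Implicit Arguments.
Unset Strict Implicit.

(** * Group actions, local compactness and isotropy groups *)

Lemma actK (G : groupType) (X : topologicalType) (a : action G X) (g : G) :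
  cancel (a g) (a g^-1%g).
Proof. by move=> x; rewrite -actM mulVg act1. Qed.

Lemma actVK (G : groupType) (X : topologicalType) (a : action G X) (g : G) :
  cancel (a g^-1%g) (a g).
Proof. by move=> x; rewrite -actM mulgV act1. Qed.

Lemma isotropy_act (G : groupType) (X : topologicalType) (a : action G X)
    (g : G) (x : X) :
  isotropy a (a g x) = conjset g (isotropy a x).
Proof.
apply/seteqP; split=> [k /= kx|_ [k /= kx <-]]; last first.
  by rewrite /isotropy /= -actM -!mulgA mulVg mulg1 actM kx.
exists (g^-1 * k * g)%g; last by rewrite !mulgA mulgV mul1g mulgK.
by rewrite /isotropy /= !actM kx actK.
Qed.

(** A closed ball inside the chart image is compact because it is closed and bounded; its image
    under the inverse chart is a compact neighbourhood. *)
Lemma manifold_compact_nbhs (R : realType) (n : nat) (M : topologicalType) :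
  topological_manifold R n M ->
  forall x : M, exists2 K : set M, compact K & nbhs x K.
Proof.
move=> [_ _ locM] x.
have [U [phi [psi [[oU Ux oV] [cphi psiK cpsi]]]]] := locM x.
have nV : nbhs (phi x) (phi @` U).
  by apply: open_nbhs_nbhs; split=> //; exists x.
have /nbhs_closedballP[e eV] := nV.
exists (psi @` closed_ball (phi x) e%:num).
  apply: continuous_compact.
    apply: continuous_in_subspaceT => v /set_mem /eV vV; exact: cpsi.
  apply: bounded_closed_compact; last exact: closed_ball_closed.
  rewrite closed_ballE//; exists (`|phi x| + e%:num).
  split; first exact: num_real.
  move=> m me v /= xv; apply: le_trans (ltW me).
  rewrite -[v](subKr (phi x)) (le_trans (ler_normB _ _))// lerD2l.
  exact: xv.
have nU : nbhs x U by exact: open_nbhs_nbhs.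
have nB : nbhs x (phi @^-1` closed_ball (phi x) e%:num).
  by apply: (cphi x Ux); apply/nbhs_closedballP; exists e.
apply: filterS2 nU nB => y Uy By; exists (phi y) => //; exact: psiK.
Qed.

Lemma hausdorff_sep (X : topologicalType) (x y : X) :
  hausdorff_space X -> x <> y ->
  exists2 A, nbhs x A & exists2 B, nbhs y B & A `&` B = set0.
Proof.
rewrite open_hausdorff => hX /eqP /hX[[A B]/= [xA yB] [oA oB /eqP AB]].
exists A; first by apply: open_nbhs_nbhs; split => //; exact: set_mem.
by exists B => //; apply: open_nbhs_nbhs; split => //; exact: set_mem.
Qed.

(* Near x only finitely many elements matter, and each of those moving x keeps
   moving the points near x. *)
Lemma isotropy_upper (G : groupType) (X : topologicalType) (a : action G X)
    (x : X) :
  hausdorff_space X -> (exists2 K : set X, compact K & nbhs x K) ->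
  proper_action a ->
  \forall y \near x, isotropy a y `<=` isotropy a x.
Proof.
move=> hX [K cK xK] /(_ _ cK)/finite_seqP[s sE].
suff : \forall y \near x, forall g, g \in s -> a g y = y -> a g x = x.
  apply: filterS2 xK => y Ky sy g gy; apply: sy => //.
  have : [set` s] g by rewrite -sE; exists y; split => //; exists y.
  by [].
elim: {sE} s => [|g s IHs]; first by near=> y.
have : \forall y \near x, a g y = y -> a g x = x.
  have [gx|/hausdorff_sep] := pselect (a g x = x); first by near=> y.
  move=> /(_ hX)[A nA [B nB AB]].
  have nA' : nbhs x (a g @^-1` A) by exact: act_cont nA.
  apply: filterS2 nB nA' => y By Ay gy.
  have : (A `&` B) y by split => //; rewrite -gy.
  by rewrite AB.
apply: filterS2 IHs => y IHy gy k; rewrite inE => /orP[/eqP->//|]; exact: IHy.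
Unshelve. all: by end_near.
Qed.

(** * The fixed point set of [H] and its translates *)

Section FixedPoints.
Variables (G : groupType) (M : topologicalType) (a : action G M).
Variable H : groupClosed G.
Local Notation MH := (fixpt a [set` H]).

Lemma fixpt_isotropy x :
  maximal_isotropy a [set` H] -> MH x -> isotropy a x = [set` H].
Proof. by move=> [_ maxH] Hx; exact: maxH. Qed.

Lemma fixpt_translate y :
  [set: M] = \bigcup_(g in [set: G]) fixpt a (conjset g [set` H]) ->
  exists g, MH (a g^-1%g y).
Proof.
move=> cov; have : [set: M] y by [].
rewrite cov => -[g _ gy]; exists g => h hH.
rewrite -[in RHS](gy (g * h * g^-1)%g); last by exists h.
by rewrite -!actM !mulgA mulVg mul1g.
Qed.

(** Both points have isotropy group exactly [H], while acting by [g] conjugates isotropy groups by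
    [g]. This is what turns statements about all of [G] into statements about the normalizer. *)
Lemma fixpt_transporter g x :
  maximal_isotropy a [set` H] -> MH x -> MH (a g x) -> g \in normalizer H.
Proof.
move=> maxH Hx Hgx; apply/normalizerP.
by rewrite -{1}(fixpt_isotropy maxH Hx) -isotropy_act fixpt_isotropy.
Qed.

(* Every isotropy group is a conjugate g H g^-1, and near a point of M^H it is
   contained in H; maximality of H then forces equality. *)
Lemma fixpt_open :
  hausdorff_space M ->
  (forall x : M, exists2 K : set M, compact K & nbhs x K) ->
  proper_action a ->
  [set: M] = \bigcup_(g in [set: G]) fixpt a (conjset g [set` H]) ->
  maximal_isotropy a [set` H] -> open MH.
Proof.
move=> hM lcM pa cov maxH; rewrite openE => x Hx.
have isox := fixpt_isotropy maxH Hx.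
apply: filterS (isotropy_upper hM (lcM x) pa) => y; rewrite isox => Hy.
have [g gy] := fixpt_translate y cov.
have isoy : isotropy a y = conjset g [set` H].
  by rewrite -[y](actVK a g) isotropy_act (fixpt_isotropy maxH gy).
(* The isotropy group [g H g^-1] of [y] is contained in [H], which fixes [x]. So [H] fixes [g^-1 x],
   and maximality applied there gives [g^-1 H g = H]. *)
have Hgx : MH (a g^-1%g x).
  move=> h hH; have : isotropy a (a g^-1%g x) h; last by [].
  rewrite isotropy_act isox; exists (g * h * g^-1)%g.
    by apply: Hy; rewrite isoy; exists h.
  by rewrite invgK !mulgA mulVg mul1g -mulgA mulVg mulg1.
have := fixpt_isotropy maxH Hgx; rewrite isotropy_act isox => gH h hH.
suff : isotropy a y h by [].
by rewrite isoy -gH -conjsetM mulgV conjset1.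
Qed.

End FixedPoints.

(** * Extension of equivariant maps from an open set that meets every orbit *)

Section EquivariantExtension.
Variables (G : groupType) (X Y : topologicalType).
Variables (aX : action G X) (aY : action G Y).

(* Stating equivariance through [val y = aX g (val x)] avoids naming the
   subgroup that preserves A. *)
Lemma equivariant_extension (A : set X) (f : A -> Y) :
  open A -> (forall x, exists g, A (aX g^-1%g x)) -> continuous f ->
  (forall g x y, val y = aX g (val x) -> f y = aY g (f x)) ->
  exists F : X -> Y, [/\ continuous F, forall g x, F (aX g x) = aY g (F x) &
    forall x, F (val x) = f x].
Proof.
move=> oA covA cf fE.
have /choice[p pE] : forall x, exists p : G * A, x = aX p.1 (val p.2).
  move=> x; have [g Agx] := covA x.
  by exists (g, exist (fun z => z \in A) _ (mem_set Agx)); rewrite /= actVK.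
pose F x := aY (p x).1 (f (p x).2).
(* The value does not depend on the chosen decomposition: if [g x = q1 q2], then [q2 = (q1^-1 g) x]
   with both points in [A], where [f] is already compatible. *)
have FE g x : F (aX g (val x)) = aY g (f x).
  rewrite /F; set q := p _; have /(congr1 (aX q.1^-1%g)) := pE (aX g (val x)).
  by rewrite actK -actM => /esym/fE ->; rewrite -actM mulgA mulgV mul1g.
exists F; split=> [x|g x|x]; last by rewrite -[val x](act1 aX) FE act1.
- rewrite (pE x); set g := (p x).1; set z := (p x).2.
  (* On the open translate [g A] the extension is [y |-> g f(g^-1 y)]. The default [z] of [insubd]
     is only taken outside this translate. *)
  pose U := aX g^-1%g @^-1` A.
  have oU : open U by apply: open_comp => // ? _; exact: act_cont.
  have Ux : U (aX g (val z)) by rewrite /U /= actK; exact: set_mem (valP z).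
  have UE y : U y -> val (insubd z (aX g^-1%g y)) = aX g^-1%g y.
    by move=> Uy; rewrite insubdK//; exact: mem_set.
  apply: (@eq_near_continuous _ _ (fun y => aY g (f (insubd z (aX g^-1%g y))))
    F _ _ oU Ux) => [y Uy|].
    by rewrite -FE UE// actVK.
  apply: (@continuous_at_comp X A Y (fun y => insubd z (aX g^-1%g y))
    (fun y => aY g (f y))).
    apply: continuous_at_subtype.
    apply: (@eq_near_continuous _ _ (aX g^-1%g) _ _ _ oU Ux) => [y Uy|].
      by rewrite UE.
    exact: act_cont.
  apply: (@continuous_at_comp A Y Y f (aY g)); first exact: cf.
  exact: act_cont.
- by rewrite (pE x) -actM !FE actM.
Qed.

Lemma equivariant_unique (A : set X) (f g : X -> Y) :
  (forall x, exists g, A (aX g^-1%g x)) ->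
  (forall k x, f (aX k x) = aY k (f x)) ->
  (forall k x, g (aX k x) = aY k (g x)) ->
  {in A, f =1 g} -> f =1 g.
Proof.
move=> covA fE gE fg x; have [k kx] := covA x.
by rewrite -[x](actVK aX k) fE gE fg//; exact: mem_set.
Qed.

End EquivariantExtension.

(** The equivalence in the last hypothesis lets both [f] and its inverse be extended. The composites
    of the extensions are equivariant and agree with the identity on [A] and on [B], hence
    everywhere. *)
Lemma equivariant_homeo_extension (G : groupType) (X Y : topologicalType)
    (aX : action G X) (aY : action G Y) (A : set X) (B : set Y) (f : A -> B) :
  open A -> (forall x, exists g, A (aX g^-1%g x)) ->
  open B -> (forall y, exists g, B (aY g^-1%g y)) ->
  homeo f ->
  (forall g x y, val y = aX g (val x) <-> val (f y) = aY g (val (f x))) ->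
  exists F : X -> Y, [/\ homeo F, forall g x, F (aX g x) = aY g (F x) &
    forall x, F (val x) = val (f x)].
Proof.
move=> oA covA oB covB [cf [f' [fK f'K cf']]] fE.
have [||F [cF FE Ff]] :=
    @equivariant_extension G X Y aX aY A (val \o f) oA covA.
- move=> x; apply: (@continuous_at_comp A B Y f val); first exact: cf.
  exact: val_continuous.
- by move=> g x y /fE.
have [||F' [cF' FE' Ff']] :=
    @equivariant_extension G Y X aY aX B (val \o f') oB covB.
- move=> x; apply: (@continuous_at_comp B A X f' val); first exact: cf'.
  exact: val_continuous.
- by move=> g x y xy /=; apply/fE; rewrite !f'K.
exists F; split=> //; split=> //; exists F'; split => //.
- apply: (equivariant_unique (aX := aX) (aY := aX) covA) => // [k x|x Ax].
    by rewrite FE FE'.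
  have -> : x = val (exist (fun z => z \in A) x Ax) by [].
  by rewrite Ff Ff' /= fK.
- apply: (equivariant_unique (aX := aY) (aY := aY) covB) => // [k x|x Bx].
    by rewrite FE' FE.
  have -> : x = val (exist (fun z => z \in B) x Bx) by [].
  by rewrite Ff' Ff /= f'K.
Qed.

(** * Homeomorphisms: restriction, inverse, composition *)

Lemma homeo_restriction (X Y : topologicalType) (A : set X) (B : set Y)
    (f : X -> Y) :
  homeo f -> (forall x, A x <-> B (f x)) ->
  exists2 f0 : A -> B, homeo f0 & forall x, val (f0 x) = f (val x).
Proof.
move=> [cf [g [fK gK cg]]] AB.
have fA (x : A) : f (val x) \in B by apply/mem_set/AB; exact: set_mem (valP x).
have gB (y : B) : g (val y) \in A.
  by apply/mem_set/AB; rewrite gK; exact: set_mem (valP y).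
exists (fun x => exist (fun z => z \in B) _ (fA x)) => //; split=> [x|].
  apply: continuous_at_subtype; apply: (@continuous_at_comp A X Y val f).
    exact: val_continuous.
  exact: cf.
exists (fun y => exist (fun z => z \in A) _ (gB y)); split=> [x|y|y].
- by apply/val_inj; rewrite /= fK.
- by apply/val_inj; rewrite /= gK.
apply: continuous_at_subtype; apply: (@continuous_at_comp B Y X val g).
  exact: val_continuous.
exact: cg.
Qed.

Lemma homeo_inverse (X Y : topologicalType) (f : X -> Y) (g : Y -> X) :
  homeo f -> cancel f g -> homeo g.
Proof.
move=> [cf [g' [fK g'K cg']]] gK.
have -> : g = g' by apply/funext => y; rewrite -[y]g'K fK gK.
by split => //; exists f.
Qed.

Lemma homeo_comp (X Y Z : topologicalType) (f : X -> Y) (g : Y -> Z) :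
  homeo f -> homeo g -> homeo (g \o f).
Proof.
move=> [cf [f' [fK f'K cf']]] [cg [g' [gK g'K cg']]]; split=> [x|].
  apply: (@continuous_at_comp X Y Z f g); [exact: cf|exact: cg].
exists (f' \o g'); split=> [x|y|y] /=; rewrite ?gK ?f'K//.
by apply: (@continuous_at_comp Z Y X g' f'); [exact: cg'|exact: cf'].
Qed.

Lemma homeo_id (X : topologicalType) : homeo (@id X).
Proof. by split=> [x //|]; exists id; split=> // x. Qed.

(** * Isomorphism of bundles as an equivalence relation *)

Section BundleIsomorphisms.
Variables (R : realType) (B : topologicalType).
Implicit Types E : vbundle R B.

(** Isomorphisms and actions are only required to respect sums and multiples; writing zero as a
    multiple shows that they respect the zero section too. *)
Lemma vscale0 E (e : E) : vscale 0 e = vzero E (proj e).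
Proof.
have [k [phi [phiI phi0 _ phiZ]]] := fibre_coord E (proj e).
by apply: phiI; rewrite ?proj_scale ?proj_zero// phiZ// scale0r phi0.
Qed.

Lemma vbundle_iso_id E : vbundle_iso (E := E) (E' := E) id id.
Proof. by split=> //; exact: homeo_id. Qed.

Lemma vbundle_iso_comp E1 E2 E3 (f g : B -> B) (Phi : E1 -> E2)
    (Psi : E2 -> E3) :
  vbundle_iso f Phi -> vbundle_iso g Psi -> vbundle_iso (g \o f) (Psi \o Phi).
Proof.
move=> [hf hPhi pPhi PhiD PhiZ] [hg hPsi pPsi PsiD PsiZ]; split.
- exact: homeo_comp.
- exact: homeo_comp.
- by move=> e; rewrite /= pPsi pPhi.
- by move=> x y xy; rewrite /= PhiD// PsiD// !pPhi xy.
- by move=> c x; rewrite /= PhiZ PsiZ.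
Qed.

Lemma vbundle_iso_inverse E1 E2 (f : B -> B) (Phi : E1 -> E2) :
  vbundle_iso f Phi -> exists (g : B -> B) (Psi : E2 -> E1),
    [/\ vbundle_iso g Psi, cancel f g, cancel g f, cancel Phi Psi &
        cancel Psi Phi].
Proof.
move=> [hf hPhi pPhi PhiD PhiZ].
have [_ [g [fK gK _]]] := hf; have [_ [Psi [PhiK PsiK _]]] := hPhi.
have pPsi e : proj (Psi e) = g (proj e) by rewrite -{2}[e]PsiK pPhi fK.
exists g, Psi; split=> //; split.
- exact: homeo_inverse fK.
- exact: homeo_inverse PhiK.
- exact: pPsi.
- move=> x y xy; apply: (can_inj PhiK).
  by rewrite PhiD ?pPsi ?xy// !PsiK.
- by move=> c x; apply: (can_inj PhiK); rewrite PhiZ !PsiK.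
Qed.

Variables (K : groupType) (a : action K B).
Implicit Types xi : ebundle R a.

Lemma act_zero xi g b : eact xi g (vzero xi b) = vzero xi (a g b).
Proof.
rewrite -[in LHS](proj_zero xi b) -vscale0 act_scale vscale0.
by rewrite proj_act !proj_zero.
Qed.

Lemma ebundle_iso_refl xi : ebundle_iso xi xi.
Proof.
exists id, id; split=> [|//|b|//]; first exact: vbundle_iso_id.
by exists 1%g; rewrite act1.
Qed.

Lemma ebundle_iso_sym xi1 xi2 : ebundle_iso xi1 xi2 -> ebundle_iso xi2 xi1.
Proof.
move=> [f [Phi [iso fE fo PhiE]]].
have [g [Psi [iso' fK gK PhiK PsiK]]] := vbundle_iso_inverse iso.
exists g, Psi; split=> // [k b|b|k e].
- by apply: (can_inj fK); rewrite fE !gK.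
- have [k kb] := fo (g b); exists k^-1%g.
  by rewrite -{2}[b]gK kb actK.
- by apply: (can_inj PhiK); rewrite PhiE !PsiK.
Qed.

Lemma ebundle_iso_trans xi1 xi2 xi3 :
  ebundle_iso xi1 xi2 -> ebundle_iso xi2 xi3 -> ebundle_iso xi1 xi3.
Proof.
move=> [f [Phi [iso fE fo PhiE]]] [g [Psi [iso' gE go PsiE]]].
exists (g \o f), (Psi \o Phi); split=> [|k b|b|k e] /=.
- exact: vbundle_iso_comp.
- by rewrite fE gE.
- have [k kb] := fo b; have [l lb] := go (f b).
  by exists (l * k)%g; rewrite lb kb actM.
- by rewrite PhiE PsiE.
Qed.

Lemma iso_class_eq (P : ebundle R a -> Prop) xi1 xi2 :
  ebundle_iso xi1 xi2 -> iso_class P xi1 = iso_class P xi2.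
Proof.
move=> iso; apply/predeqP => xi; split=> -[Pxi iso']; split=> //.
  exact: ebundle_iso_trans (ebundle_iso_sym iso) iso'.
exact: ebundle_iso_trans iso iso'.
Qed.

Lemma iso_classes_inj (P : ebundle R a -> Prop) (c d : iso_classes P) :
  proj1_sig c = proj1_sig d -> c = d.
Proof. by case: c d => c Pc [d Pd] /= cd; exact: eq_exist. Qed.

End BundleIsomorphisms.

(** * Restriction to the fixed point set preserves and reflects isomorphism *)

Section RestrictionToFixedPoints.
Variables (R : realType) (G : groupType) (M : topologicalType).
Variables (a : action G M) (H : groupClosed G).
Local Notation MH := (fixpt a [set` H]).
Local Notation N := (normalizer H).
Hypothesis maxH : maximal_isotropy a [set` H].

(** An equivariant homeomorphism preserves isotropy groups, so the base map and the bundle map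
    restrict. *)
Lemma restr_fixpt_iso (xi xi' : ebundle R a) :
  ebundle_iso xi xi' -> ebundle_iso (restr_fixpt H xi) (restr_fixpt H xi').
Proof.
move=> [f [Phi [[hf hPhi pPhi PhiD PhiZ] fE fo PhiE]]].
have fMH x : MH x <-> MH (f x).
  have [_ [f' [fK f'K _]]] := hf; split=> Hx h hH; first by rewrite -fE Hx.
  by apply: (can_inj fK); rewrite fE Hx.
have [f0 hf0 f0E] := homeo_restriction hf fMH.
have PhiMH e : @rtot R M xi MH e <-> @rtot R M xi' MH (Phi e).
  by rewrite /rtot /= pPhi.
have [Phi0 hPhi0 Phi0E] := homeo_restriction hPhi PhiMH.
exists f0, (Phi0 : restr xi MH -> restr xi' MH); split.
- split=> // [e|x y xy|c x]; apply/val_inj => /=.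
  + by rewrite f0E Phi0E pPhi.
  + have pxy : proj (val x) = proj (val y) by exact: (congr1 val xy).
    rewrite Phi0E !val_radd ?Phi0E ?PhiD//.
    by apply/val_inj; rewrite /= !Phi0E !pPhi pxy.
  + by rewrite !Phi0E PhiZ.
- by move=> g x; apply/val_inj; rewrite /= !f0E fE.
- move=> x; have [g gx] := fo (val x).
  have Hx : MH (val x) by exact: set_mem (valP x).
  (* Being the identity on [M / G] must become being the identity on [M^H / N(H)]: as [g] moves a
     point of [M^H] to a point of [M^H], it normalizes [H]. *)
  have gN : g \in N.
    apply: (fixpt_transporter maxH Hx); rewrite -gx.
    by have := proj1 (fMH _) Hx.
  by exists (exist (fun z => z \in N) g gN); apply/val_inj; rewrite /= f0E gx.
- by move=> g e; apply/val_inj; rewrite /= !Phi0E PhiE.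
Qed.

Hypothesis oMH : open MH.
Hypothesis covM : forall y, exists g, MH (a g^-1%g y).

(** The parts over [M^H] are open and meet every orbit, so the base map and the bundle map both
    extend. Linearity, the covering relation and the orbit condition hold over [M^H] and are carried
    along by the action. *)
Lemma restr_fixpt_iso_inj (xi xi' : ebundle R a) :
  ebundle_iso (restr_fixpt H xi) (restr_fixpt H xi') -> ebundle_iso xi xi'.
Proof.
move=> [f0 [Phi0 [[hf0 hPhi0 pPhi0 Phi0D Phi0Z] f0E f0o Phi0E]]].
have [_ [f0' [f0K _ _]]] := hf0; have [_ [Phi0' [Phi0K _ _]]] := hPhi0.
have MHv (x : MH) : MH (val x) by exact: set_mem (valP x).
(* Equivariance is given for the normalizer only, but any [g] relating two points of [M^H] lies in
   it. Injectivity of [f0] gives the converse implication. *)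
have gf0 g (x y : MH) : val y = a g (val x) <-> val (f0 y) = a g (val (f0 x)).
  split=> xy.
    have gN : g \in N by apply: (fixpt_transporter maxH (MHv x)); rewrite -xy.
    have -> : y = fixpt_action a H (exist (fun z => z \in N) g gN) x.
      exact/val_inj.
    by rewrite f0E.
  have gN : g \in N.
    by apply: (fixpt_transporter maxH (MHv (f0 x))); rewrite -xy.
  suff -> : y = fixpt_action a H (exist (fun z => z \in N) g gN) x by [].
  by apply: (can_inj f0K); rewrite f0E; exact/val_inj.
have [f [hf fE ff0]] := equivariant_homeo_extension oMH covM oMH covM hf0 gf0.
have covE (E : ebundle R a) e : exists g, @rtot R M E MH (eact E g^-1%g e).
  by have [g gx] := covM (proj e); exists g; rewrite /rtot /= proj_act.
have oE (E : ebundle R a) : open (@rtot R M E MH).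
  by apply: open_comp => // ? _; exact: proj_cont.
have gPhi0 g (x y : restr xi MH) :
    val y = eact xi g (val x) <-> val (Phi0 y) = eact xi' g (val (Phi0 x)).
  split=> xy.
    have gN : g \in N.
      apply: (fixpt_transporter maxH (MHv (proj x))).
      by have := MHv (proj y); rewrite /= xy proj_act.
    have -> : y = eact (restr_fixpt H xi) (exist (fun z => z \in N) g gN) x.
      exact/val_inj.
    by rewrite Phi0E.
  have gN : g \in N.
    apply: (fixpt_transporter maxH (MHv (proj (Phi0 x)))).
    by have := MHv (proj (Phi0 y)); rewrite /= xy proj_act.
  suff -> : y = eact (restr_fixpt H xi) (exist (fun z => z \in N) g gN) x by [].
  by apply: (can_inj Phi0K); rewrite Phi0E; exact/val_inj.
have [Phi [hPhi PhiE PhiPhi0]] := equivariant_homeo_extension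
  (oE xi) (covE xi) (oE xi') (covE xi') hPhi0 gPhi0.
(* Every vector is a translate of one over [M^H]; vectors of one fibre can be translated by the same
   [g], which reduces additivity to [Phi0]. *)
have lift g (e : xi) : MH (a g^-1%g (proj e)) ->
    exists2 e0 : restr xi MH,
      e = eact xi g (val e0) & val (proj e0) = a g^-1%g (proj e).
  move=> He; have He' : eact xi g^-1%g e \in @rtot R M xi MH.
    by apply/mem_set; rewrite /rtot /= proj_act.
  by exists (exist (fun z => z \in @rtot R M xi MH) _ He');
    rewrite /= ?actVK ?proj_act.
have PhiL g (e0 : restr xi MH) :
    Phi (eact xi g (val e0)) = eact xi' g (val (Phi0 e0)).
  by rewrite PhiE PhiPhi0.
exists f, Phi; split=> //; first split=> //.
- move=> e; have [g ge] := covM (proj e); have [e0 -> _] := lift g e ge.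
  rewrite PhiL !proj_act fE; congr (a g _).
  by have /(congr1 val)/= -> := pPhi0 e0; rewrite -ff0.
- move=> x y xy; have [g gx] := covM (proj x).
  have [x0 xE px0] := lift g x gx.
  have gy := gx; rewrite xy in gy; have [y0 yE py0] := lift g y gy.
  have xy0 : proj x0 = proj y0 by apply/val_inj; rewrite px0 py0 xy.
  have xy0' : proj (val x0) = proj (val y0) by exact: (congr1 val xy0).
  rewrite xE yE -act_add// -(val_radd xy0) !PhiL (Phi0D _ _ xy0).
  rewrite val_radd; last by rewrite [LHS]pPhi0 [RHS]pPhi0 xy0.
  rewrite act_add//.
  have pE z : proj (val (Phi0 z)) = val (f0 (proj z)) by rewrite -pPhi0.
  by rewrite !pE xy0.
- move=> c x; have [g gx] := covM (proj x); have [x0 -> _] := lift g x gx.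
  rewrite -act_scale PhiL -act_scale -[vscale c (val x0)]/(val (vscale c x0)).
  by rewrite PhiL Phi0Z.
- move=> x; have [g gx] := covM x.
  have [m mx] := f0o (exist (fun z => z \in MH) _ (mem_set gx)).
  (* With [x = g x0] and [f0 x0 = m x0], equivariance gives [f x = g m x0 = (g m g^-1) x]. *)
  exists (g * val m * g^-1)%g.
  rewrite -{1}[x](actVK a g) fE !actM; congr (a g _).
  by have := ff0 (exist (fun z => z \in MH) _ (mem_set gx));
    rewrite /= => ->; rewrite mx.
Qed.

(** If [g H g^-1] fixes [e], then [H] fixes [g^-1 e] and, the projection being equivariant, also its
    base point. So [g^-1 e] lies over [M^H]. The converse is the case [g = 1]. *)
Lemma no_fixed_points_restr (xi : ebundle R a) :
  no_fixed_points (restr_fixpt H xi) (range (to_normalizer (H := H))) <->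
  forall g, no_fixed_points xi (conjset g [set` H]).
Proof.
split=> nofix.
- move=> g e ge; pose e' := eact xi g^-1%g e.
  have He' h : h \in H -> eact xi h e' = e'.
    move=> hH; rewrite /e' -[in RHS](ge (g * h * g^-1)%g); last by exists h.
    by rewrite -!actM !mulgA mulVg mul1g.
  have MHe' : e' \in @rtot R M xi MH.
    by apply/mem_set => h hH; rewrite -proj_act He'.
  pose e0 : restr_fixpt H xi := exist (fun z => z \in @rtot R M xi MH) e' MHe'.
  have : e0 = vzero (restr_fixpt H xi) (proj e0).
    apply: nofix => _ [h _ <-]; apply/val_inj; exact: He' (valP h).
  move=> /(congr1 val)/= e'0; rewrite -[e](actVK (eact xi) g) -/e' e'0 act_zero.
  by rewrite proj_zero /e' proj_act actVK.
- move=> e He; apply/val_inj => /=; apply: (nofix 1%g).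
  rewrite conjset1 => h hH.
  have /(congr1 val) := He (to_normalizer (exist _ h hH)) (imageT _ _).
  by [].
Qed.

End RestrictionToFixedPoints.

(** * Products with a discrete factor, and representatives of left cosets *)

Lemma continuous_discrete_prod (D : choiceType) (X Y : topologicalType)
    (f : discrete_topology D * X -> Y) :
  (forall d, continuous (fun x => f (d, x))) -> continuous f.
Proof.
(* The slice over [d] is open because the first factor is discrete, so continuity can be checked on
   that slice alone. *)
move=> cf [d x]; pose U : set (discrete_topology D * X) := fst @^-1` [set d].
apply: (@eq_near_continuous (discrete_topology D * X)%type Y
  (fun p => f (d, p.2)) f (d, x) U) => //.
- apply: open_comp => [? _|]; first exact: continuous_fst.
  exact: discrete_open.
- by move=> [d' x']; rewrite /U /= => ->.
apply: (@continuous_at_comp (discrete_topology D * X)%type X Y snd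
  (fun x => f (d, x))); first exact: continuous_snd.
exact: cf.
Qed.

Section CosetRepresentatives.
Variables (G : groupType) (K : groupClosed G).

(** [choose] depends only on the extension of a predicate once it has a witness, so the result
    depends only on the coset [g K]. It need not be [1] on the trivial coset. *)
Definition coset_rep (g : G) : G := choose (fun h => (g^-1 * h)%g \in K) g.

Lemma coset_repP g : (g^-1 * coset_rep g)%g \in K.
Proof.
by apply: (@chooseP _ (fun h => (g^-1 * h)%g \in K)); rewrite mulVg gpred1.
Qed.

Lemma coset_rep_eq g h : (g^-1 * h)%g \in K -> coset_rep g = coset_rep h.
Proof.
move=> gh; rewrite /coset_rep (choose_id (y0 := h)) ?mulVg ?gpred1//.
apply: eq_choose => k /=; apply/idP/idP => gk.
  suff -> : (h^-1 * k = (g^-1 * h)^-1 * (g^-1 * k))%g by rewrite gpredM ?gpredV.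
  by rewrite invgM invgK -mulgA (mulgA g) mulgV mul1g.
suff -> : (g^-1 * k = (g^-1 * h) * (h^-1 * k))%g by rewrite gpredM.
by rewrite -mulgA (mulgA h) mulgV mul1g.
Qed.

Lemma coset_rep_id g : coset_rep (coset_rep g) = coset_rep g.
Proof. by apply/esym/coset_rep_eq; exact: coset_repP. Qed.

Definition transversal := {t : G | coset_rep t == t}.

Definition to_transversal (g : G) : transversal :=
  exist _ (coset_rep g) (introT eqP (coset_rep_id g)).

Lemma transversalK (t : transversal) : to_transversal (val t) = t.
Proof. by apply/val_inj; exact/eqP/(valP t). Qed.

Lemma to_transversal_eq g h : (g^-1 * h)%g \in K ->
  to_transversal g = to_transversal h.
Proof. by move=> gh; apply/val_inj; exact: coset_rep_eq. Qed.

Lemma cocycle_subproof g (t : transversal) :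
  ((val (to_transversal (g * val t)))^-1 * (g * val t))%g \in K.
Proof.
rewrite -[X in X \in _]invgK gpredV invgM invgK; exact: coset_repP.
Qed.

(* G acts on G x_K E through the cocycle of this section of G -> G / K. *)
Definition cocycle (g : G) (t : transversal) : subgrp K :=
  exist _ ((val (to_transversal (g * val t)))^-1 * (g * val t))%g
    (cocycle_subproof g t).

Lemma cocycleE g t :
  (g * val t = val (to_transversal (g * val t)) * val (cocycle g t))%g.
Proof. by rewrite /= mulgA mulgV mul1g. Qed.

Lemma to_transversal1 (t : transversal) : to_transversal (1 * val t)%g = t.
Proof. by rewrite mul1g transversalK. Qed.

Lemma cocycle1 t : cocycle 1%g t = 1%g.
Proof.
apply/val_inj; apply: (mulgI (val (to_transversal (1 * val t)%g))).
by rewrite -cocycleE to_transversal1 mul1g mulg1.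
Qed.

Lemma to_transversalM g h (t : transversal) :
  to_transversal (g * h * val t)%g =
  to_transversal (g * val (to_transversal (h * val t)))%g.
Proof.
apply: to_transversal_eq; rewrite !invgM -!mulgA (mulgA g^-1%g) mulVg mul1g.
by rewrite mulgA -invgM; exact: coset_repP.
Qed.

(** Both sides arise from decomposing [g h t] as a representative times an element of [K], and the
    representatives agree. This identity makes the induced action multiplicative. *)
Lemma cocycleM g h t :
  cocycle (g * h) t = (cocycle g (to_transversal (h * val t)) * cocycle h t)%g.
Proof.
apply/val_inj; apply: (mulgI (val (to_transversal (g * h * val t)%g))).
rewrite -cocycleE to_transversalM [RHS]mulgA -cocycleE -!mulgA; congr (_ * _)%g.
exact: cocycleE.
Qed.

End CosetRepresentatives.

(** * Transport of the bundle conditions along isomorphisms *)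

Lemma of_type_iso (R : realType) (G : groupType) (M : topologicalType)
    (a : action G M) (H : groupClosed G) (V F : vectType (cplx R))
    (rho : subgrp H -> 'End(V)) (eta eta' : ebundle R (fixpt_action a H))
    (Psi : eta -> eta') :
  vbundle_iso id Psi ->
  (forall g e, Psi (eact eta g e) = eact eta' g (Psi e)) ->
  of_type F rho eta' -> of_type F rho eta.
Proof.
move=> iso PsiE [eta0 [Phi [fib iso0 PhiE]]].
exists eta0, (Phi \o Psi); split=> // [|h e].
  exact: (vbundle_iso_comp iso iso0).
by rewrite /= PsiE PhiE.
Qed.

Lemma no_fixed_points_iso (R : realType) (K : groupType) (B : topologicalType)
    (a : action K B) (eta eta' : ebundle R a) (f : B -> B) (Psi : eta -> eta')
    (A : set K) :
  vbundle_iso f Psi -> (forall g e, Psi (eact eta g e) = eact eta' g (Psi e)) ->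
  no_fixed_points eta' A -> no_fixed_points eta A.
Proof.
move=> [_ [_ [Psi' [PsiK _ _]]] _ _ PsiZ] PsiE nofix e Ae.
apply: (can_inj PsiK); rewrite -vscale0 PsiZ vscale0; apply: nofix => g Ag.
by rewrite -PsiE Ae.
Qed.

(** * The induced bundle and its restriction to the fixed point set *)

Section InducedBundle.
Variables (R : realType) (G : groupType) (M : topologicalType).
Variables (a : action G M) (H : groupClosed G).
Local Notation MH := (fixpt a [set` H]).
Local Notation N := (normalizer H).
Local Notation T := (discrete_topology (transversal N)).
Hypothesis maxH : maximal_isotropy a [set` H].
Hypothesis oMH : open MH.
Hypothesis covM : forall y, exists g, MH (a g^-1%g y).
Variable eta : ebundle R (fixpt_action a H).

(** The element [t'^-1 t] carries a point of [M^H] into [M^H], so it normalizes [H]. Then [t] and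
    [t'] represent the same coset and coincide. *)
Lemma act_transversal_inj (t t' : transversal N) (x x' : MH) :
  a (val t) (val x) = a (val t') (val x') -> t = t' /\ x = x'.
Proof.
move=> tx; have x'E : val x' = a ((val t')^-1 * val t)%g (val x).
  by rewrite actM tx actK.
have tt : t' = t.
  rewrite -(transversalK t) -(transversalK t'); apply: to_transversal_eq.
  apply: (fixpt_transporter (x := val x) maxH).
    exact: set_mem (valP x).
  by rewrite -x'E; exact: set_mem (valP x').
split=> //; apply/val_inj; rewrite x'E tt mulVg act1//.
Qed.

(** Replacing [g] by its coset representative changes [g^-1 y] by an element of the normalizer,
    which preserves [M^H]. *)
Lemma chart_subproof y :
  exists p : transversal N * MH, a (val p.1) (val p.2) = y.
Proof.
have [g gy] := covM y; set t := to_transversal N g.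
have ty : a (val t)^-1%g y \in MH.
  apply/mem_set; have -> : a (val t)^-1%g y = a ((val t)^-1 * g)%g (a g^-1%g y).
    by rewrite actM actVK.
  apply: fixpt_normalizer gy.
  by rewrite -gpredV invgM invgK; exact: coset_repP.
by exists (t, exist (fun z => z \in MH) _ ty); rewrite /= actVK.
Qed.

Definition chart (y : M) : T * MH := projT1 (cid (chart_subproof y)).

Lemma chartK y : a (val (chart y).1) (val (chart y).2) = y.
Proof. exact: projT2 (cid (chart_subproof y)). Qed.

Lemma chart_act (t : transversal N) (x : MH) :
  chart (a (val t) (val x)) = (t, x).
Proof.
have [] := act_transversal_inj (chartK (a (val t) (val x))).
by case: chart => ? ? /= -> ->.
Qed.

(** On the open translate [t M^H] the first coordinate is constantly [t] and the second is
    [z |-> t^-1 z]. *)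
Lemma chart_cont : continuous chart.
Proof.
move=> y; set t := (chart y).1; set x := (chart y).2.
pose U := a (val t)^-1%g @^-1` MH.
have oU : open U by apply: open_comp => // ? _; exact: act_cont.
have Uy : U y.
  rewrite /U /= -[y]chartK -/t -/x actK; exact: set_mem (valP x).
have UE z : U z -> val (insubd x (a (val t)^-1%g z)) = a (val t)^-1%g z.
  by move=> Uz; rewrite insubdK//; exact: mem_set.
apply: (@eq_near_continuous M (T * MH)%type
  (fun z => (t, insubd x (a (val t)^-1%g z))) chart y U) => // [z Uz|].
  by rewrite -chart_act UE// actVK.
apply: (@continuous_at_pair M T MH); first exact: cst_continuous.
apply: continuous_at_subtype.
apply: (@eq_near_continuous _ _ (a (val t)^-1%g) _ y U) => // [z Uz|].
  by rewrite UE.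
exact: act_cont.
Qed.

(* The induced bundle G x_{N(H)} eta, represented as transversal x eta; its
   projection identifies M with transversal x M^H through [chart]. *)
Definition ind_tot : topologicalType := (T * eta)%type.

Definition ind_proj (p : ind_tot) : M := a (val p.1) (val (proj p.2)).

Definition ind_zero (y : M) : ind_tot := ((chart y).1, vzero eta (chart y).2).

Definition ind_add (p q : ind_tot) : ind_tot := (p.1, vadd p.2 q.2).

Definition ind_scale (c : cplx R) (p : ind_tot) : ind_tot :=
  (p.1, vscale c p.2).

Lemma chart_ind_proj p : chart (ind_proj p) = (p.1, proj p.2).
Proof. exact: chart_act. Qed.

Lemma ind_proj_eq p q :
  ind_proj p = ind_proj q -> p.1 = q.1 /\ proj p.2 = proj q.2.
Proof. exact: act_transversal_inj. Qed.

Lemma ind_proj_cont : continuous ind_proj.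
Proof.
apply: continuous_discrete_prod => t e.
apply: (@continuous_at_comp eta M M (fun e => val (proj e)) (a (val t))).
  apply: (@continuous_at_comp eta MH M (@proj R MH eta) val).
    exact: proj_cont.
  exact: val_continuous.
exact: act_cont.
Qed.

Lemma ind_proj_zero y : ind_proj (ind_zero y) = y.
Proof. by rewrite /ind_proj /= proj_zero chartK. Qed.

Lemma ind_proj_add p q : ind_proj p = ind_proj q ->
  ind_proj (ind_add p q) = ind_proj p.
Proof. by move=> /ind_proj_eq[_ pq]; rewrite /ind_proj /= proj_add. Qed.

Lemma ind_proj_scale c p : ind_proj (ind_scale c p) = ind_proj p.
Proof. by rewrite /ind_proj /= proj_scale. Qed.

Definition ind_fam : vfamily R M :=
  VFamily ind_proj_cont ind_proj_zero ind_proj_add ind_proj_scale.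

(** The map [ch2] identifies each fibre with a fibre of [eta]. Pulling a trivialization over [U]
    back along it gives one over the union of all translates [t U] at once. *)
Lemma ind_loc_triv (y : M) : exists (U : set M) (k : nat) phi psi,
  [/\ open U, U y & trivialization (E := ind_fam) U (k := k) phi psi].
Proof.
have [U [k [phi [psi [oU Uy triv]]]]] := loc_triv eta (chart y).2.
pose ch2 z := (chart z).2.
have ch2_cont : continuous ch2.
  move=> z; apply: (@continuous_at_comp M (T * MH)%type MH chart snd).
    exact: chart_cont.
  exact: continuous_snd.
exists (ch2 @^-1` U), k, (fun p : ind_tot => phi p.2),
  (fun q => ((chart q.1).1, psi (ch2 q.1, q.2))).
have chp (p : ind_fam) : chart (proj p) = (p.1, proj p.2).
  exact: chart_ind_proj.
split=> //; first by apply: open_comp => // ? _; exact: ch2_cont.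
split=> /=.
- move=> p; rewrite /ch2 chp => Up.
  apply: (@continuous_at_comp ind_tot eta _ snd phi).
    exact: continuous_snd.
  exact: (triv_cont triv).
- move=> q Uq.
  have fst_ch : continuous (fun q : M * 'rV[cplx R]_k => chart q.1).
    move=> z; apply: (@continuous_at_comp _ M (T * MH)%type fst chart).
      exact: continuous_fst.
    exact: chart_cont.
  apply: (@continuous_at_pair (M * 'rV[cplx R]_k)%type T eta).
    apply: (@continuous_at_comp _ (T * MH)%type T (fun q => chart q.1) fst).
      exact: fst_ch.
    exact: continuous_fst.
  apply: (@continuous_at_comp _ (MH * 'rV[cplx R]_k)%type eta
    (fun q => (ch2 q.1, q.2)) psi); last exact: (triv_inv_cont triv).
  apply: (@continuous_at_pair _ MH).
    apply: (@continuous_at_comp _ (T * MH)%type MH (fun q => chart q.1) snd).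
      exact: fst_ch.
    exact: continuous_snd.
  exact: continuous_snd.
- by move=> q Uq; rewrite /ind_proj /= (triv_proj triv)//= chartK.
- by move=> q Uq; rewrite (trivK triv).
- move=> p; rewrite /ch2 chp /= => Up; rewrite (triv_invK triv)//.
  by case: p {Up}.
- by move=> z Uz; exact: (triv_zero triv).
- move=> p q; rewrite /ch2 chp /= => Up /ind_proj_eq[_ pq].
  exact: (triv_add triv).
- by move=> c p; rewrite /ch2 chp /= => Up; exact: (triv_scale triv).
Qed.

Definition ind_bundle : vbundle R M := VBundle ind_loc_triv.

(** In [G x_{N(H)} eta] one has [g [t, e] = [t' n, e] = [t', n e]], where [g t = t' n] with [t'] in
    the transversal and [n] the cocycle. *)
Definition ind_act (g : G) (p : ind_bundle) : ind_bundle :=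
  (to_transversal N (g * val p.1)%g, eact eta (cocycle g p.1) p.2).

Lemma ind_act1 p : ind_act 1%g p = p.
Proof.
by case: p => t e; rewrite /ind_act /= cocycle1 act1 to_transversal1.
Qed.

Lemma ind_actM g h p : ind_act (g * h)%g p = ind_act g (ind_act h p).
Proof. by rewrite /ind_act /= cocycleM actM to_transversalM. Qed.

Lemma ind_act_cont g : continuous (ind_act g).
Proof.
apply: continuous_discrete_prod => t e.
apply: (@continuous_at_pair eta T eta); first exact: cst_continuous.
exact: act_cont.
Qed.

Lemma ind_proj_act g p :
  proj ((Action ind_act1 ind_actM ind_act_cont) g p) = a g (proj p).
Proof.
by rewrite /= /ind_proj /= proj_act -!actM [RHS]actM -actM -cocycleE actM.
Qed.

Lemma ind_act_add g (p q : ind_bundle) : proj p = proj q ->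
  ind_act g (vadd p q) = vadd (ind_act g p) (ind_act g q).
Proof.
move=> /ind_proj_eq[tt pq]; rewrite /ind_act /= /ind_add /= act_add//.
by rewrite tt.
Qed.

Lemma ind_act_scale g c (p : ind_bundle) :
  ind_act g (vscale c p) = vscale c (ind_act g p).
Proof. by rewrite /ind_act /= /ind_scale /= act_scale. Qed.

Definition induced : ebundle R a :=
  EBundle (eact := Action ind_act1 ind_actM ind_act_cont)
    ind_proj_act ind_act_add ind_act_scale.

(** The representative of the trivial coset may differ from [1]; the correction [[t0, e] =
    [1, t0 e]] is why [n0] acts in the comparison with [eta]. *)
Let t0 : transversal N := to_transversal N 1%g.

Lemma to_transversal_id g : g \in N -> to_transversal N g = t0.
Proof. by move=> gN; apply/esym/to_transversal_eq; rewrite invg1 mul1g. Qed.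

Lemma val_t0_in : val t0 \in N.
Proof.
by rewrite -[val t0]mul1g -[1%g in X in X \in _]invg1; exact: coset_repP.
Qed.

Let n0 : subgrp N := exist _ (val t0) val_t0_in.

(** If [x] and [t x] both lie in [M^H], then [t] normalizes [H]. Hence only the sheet of the trivial
    coset lies over [M^H]. *)
Lemma restr_induced_coset (e : restr_fixpt H induced) : (val e).1 = t0.
Proof.
have eMH : MH (ind_proj (val e)) by exact: set_mem (valP e).
rewrite -(to_transversal_id (g := val (val e).1)) ?transversalK//.
apply: (fixpt_transporter maxH _ eMH); exact: set_mem (valP (proj (val e).2)).
Qed.

Definition restr_induced_map (e : restr_fixpt H induced) : eta :=
  eact eta n0 (val e).2.

Lemma restr_induced_inv_subproof (e : eta) :
  ((t0, eact eta n0^-1%g e) : ind_bundle) \in @rtot R M induced MH.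
Proof.
apply/mem_set; rewrite /rtot /= /ind_proj /= proj_act /= actVK.
exact: set_mem (valP (proj e)).
Qed.

Definition restr_induced_inv (e : eta) : restr_fixpt H induced :=
  exist _ ((t0, eact eta n0^-1%g e) : ind_bundle)
    (restr_induced_inv_subproof e).

Lemma restr_induced_iso : vbundle_iso id restr_induced_map.
Proof.
split=> [|||x y xy|c x]; first exact: homeo_id.
- split=> [e|].
    apply: (@continuous_at_comp (restr_fixpt H induced) ind_tot eta val
      (fun p => eact eta n0 p.2)); first exact: val_continuous.
    apply: (@continuous_at_comp ind_tot eta eta snd (eact eta n0)).
      exact: continuous_snd.
    exact: act_cont.
  exists restr_induced_inv; split=> [e|e|e].
  + apply/val_inj; rewrite /= /restr_induced_map actK.
    by rewrite [RHS]surjective_pairing restr_induced_coset.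
  + by rewrite /restr_induced_map /= actVK.
  + apply: continuous_at_subtype; apply: (@continuous_at_pair eta T eta).
      exact: cst_continuous.
    exact: act_cont.
- move=> e; rewrite /restr_induced_map proj_act; apply/val_inj => /=.
  by rewrite /ind_proj restr_induced_coset.
- have /ind_proj_eq[_ pxy] : ind_proj (val x) = ind_proj (val y).
    exact: (congr1 val xy).
  by rewrite /restr_induced_map val_radd//= act_add.
- by rewrite /restr_induced_map /= act_scale.
Qed.

(** For [g] in the normalizer the cocycle relation at [t0] reads [g t0 = t0 n], so applying [t0]
    after [n] is applying [g] after [t0]. *)
Lemma restr_induced_equivariant g e :
  restr_induced_map (eact (restr_fixpt H induced) g e) =
  eact eta g (restr_induced_map e).
Proof.
rewrite /restr_induced_map /= -!actM restr_induced_coset; congr (eact eta _ _).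
apply/val_inj; rewrite [RHS]cocycleE to_transversal_id// gpredM//.
  exact: (valP g).
exact: val_t0_in.
Qed.

End InducedBundle.

(** * The correspondence between isomorphism classes *)

Lemma quasi_free_restr (R : realType) (G : groupType) (M : topologicalType)
    (a : action G M) (H : groupClosed G) (F V : vectType (cplx R))
    (rho : subgrp H -> 'End(V)) (xi : ebundle R a) :
  quasi_free_bundle F rho xi <-> normalizer_bundle F rho (restr_fixpt H xi).
Proof.
split=> -[nofix ty]; split=> //; exact/no_fixed_points_restr.
Qed.

Theorem theorem8 (R : realType) (n : nat) (G : groupType)
    (M : topologicalType) (a : action G M) (H : groupClosed G)
    (F V : vectType (cplx R)) (dotV : {dot V for Num.conj})
    (rho : subgrp H -> 'End(V)) :
  topological_manifold R n M ->
  proper_action a ->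
  finite_set [set` H] ->
  unitary_representation dotV rho ->
  irreducible rho ->
  (forall m : subgrp (normalizer H),
    equivalent_representations (conj_representation rho m) rho) ->
  [set: M] = \bigcup_(g in [set: G]) fixpt a (conjset g [set` H]) ->
  maximal_isotropy a [set` H] ->
  exists r : Vect_quasi_free a F rho -> Vect_normalizer a F rho,
    bijective r /\
    forall (xi : ebundle R a) (Pxi : quasi_free_bundle F rho xi),
      exists Pres : normalizer_bundle F rho (restr_fixpt H xi),
        r (class_of Pxi) = class_of Pres.

Proof.
move=> manM pa _ _ _ _ cov maxH.
have [hM _ _] := manM.
have oMH := fixpt_open hM (manifold_compact_nbhs manM) pa cov maxH.
have covM y := fixpt_translate y cov.
pose P := @quasi_free_bundle R G M a H V F rho.
pose Q := @normalizer_bundle R G M a H V F rho.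
have PQ xi : P xi <-> Q (restr_fixpt H xi) by exact: quasi_free_restr.
(* Classes are predicates, so both maps are defined without choosing
   representatives. *)
pose res (c : ebundle R a -> Prop) : ebundle R (fixpt_action a H) -> Prop :=
  fun eta => Q eta /\ exists2 xi, c xi & ebundle_iso (restr_fixpt H xi) eta.
pose ext (d : ebundle R (fixpt_action a H) -> Prop) : ebundle R a -> Prop :=
  fun xi => P xi /\ d (restr_fixpt H xi).
have resE xi : P xi -> res (iso_class P xi) = iso_class Q (restr_fixpt H xi).
  move=> Pxi; apply/predeqP => eta.
  split=> [[Qeta [xi' [_ iso] iso']]|[Qeta iso]].
    split=> //; apply: ebundle_iso_trans iso'; exact: restr_fixpt_iso.
  split=> //; exists xi => //; split=> //; exact: ebundle_iso_refl.
(* This is where injectivity of restriction enters: bundles with isomorphic restrictions are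
   isomorphic. *)
have extE xi : P xi -> ext (iso_class Q (restr_fixpt H xi)) = iso_class P xi.
  move=> Pxi; apply/predeqP => xi'; split=> [[Pxi' [_ iso]]|[Pxi' iso]].
    split=> //; exact: restr_fixpt_iso_inj iso.
  by split=> //; split; [exact/PQ | exact: restr_fixpt_iso].
(* Surjectivity: the induced bundle restricts to [eta] up to isomorphism, so each class over [M^H]
   is the class of a restriction and [extE] applies to it. *)
have onto eta : Q eta ->
    exists2 xi, P xi & iso_class Q eta = iso_class Q (restr_fixpt H xi).
  move=> [nofix ty]; have iso := restr_induced_iso maxH oMH covM eta.
  have isoE := @restr_induced_equivariant _ _ _ _ _ maxH oMH covM eta.
  exists (induced maxH oMH covM eta).
    apply/PQ; split; last exact: (of_type_iso iso isoE ty).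
    exact: (no_fixed_points_iso iso isoE nofix).
  apply/iso_class_eq/ebundle_iso_sym.
  exists id, (@restr_induced_map _ _ _ _ _ maxH oMH covM eta).
  by split=> // b; exists 1%g; rewrite act1.
have resP (c : Vect_quasi_free a F rho) :
    exists2 eta, Q eta & res (proj1_sig c) = iso_class Q eta.
  case: c => c [xi Pxi cE]; exists (restr_fixpt H xi); first exact/PQ.
  by rewrite /= cE resE.
have extP (d : Vect_normalizer a F rho) :
    exists2 xi, P xi & ext (proj1_sig d) = iso_class P xi.
  case: d => d [eta Qeta dE]; have [xi Pxi e] := onto eta Qeta.
  by exists xi; rewrite //= dE e extE.
exists (fun c => exist (fun k => exists2 eta, Q eta & k = iso_class Q eta) _
  (resP c)); split.
  exists (fun d => exist (fun k => exists2 xi, P xi & k = iso_class P xi) _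
    (extP d)) => [c|d]; apply: iso_classes_inj => /=.
    by case: c => c [xi Pxi cE] /=; rewrite cE resE// extE.
  case: d => d [eta Qeta dE] /=; have [xi Pxi e] := onto eta Qeta.
  by rewrite dE e extE// resE.
move=> xi Pxi; have Qxi := proj1 (PQ xi) Pxi; exists Qxi.
by apply: iso_classes_inj; rewrite /= resE.
Qed.
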